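(* The class of unit box intersection graphs in $\mathbb{R}^2$ has unbounded symmetric difference; that is, for every integer $k$ there exists a unit box intersection graph $G$ in $\mathbb{R}^2$ with $\mathrm{sd}(G)>k$.
   Context: All graphs are finite, undirected, without loops and multiple edges. A box in $\mathbb{R}^d$ is a solid $d$-dimensional rectangle with axis-parallel sides (a product of $d$ closed intervals); a unit box is a box with all sides of length $1$. A graph $G$ is a unit box intersection graph in $\mathbb{R}^d$ if each vertex of $G$ can be associated with a unit box in $\mathbb{R}^d$ so that two distinct vertices of $G$ are adjacent if and only if the corresponding boxes intersect. For a graph $G$ and distinct vertices $x,y$ of $G$, let $\mathrm{sd}_G(x,y)$ be the number of vertices of $G$ different from $x$ and $y$ that are adjacent to exactly one of $x$ and $y$. The symmetric difference of $G$, denoted $\mathrm{sd}(G)$, is $0$ if $G$ is a single-vertex graph, and otherwise $$\mathrm{sd}(G)=\max_H\min_{x,y\in V(H),\,x\ne y}\mathrm{sd}_H(x,y),$$ where the maximum is over all induced subgraphs $H$ of $G$ with at least two vertices. *)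

(* Defs.v *)
From mathcomp Require Import all_boot all_order all_algebra.
From mathcomp Require Import classical_sets reals.

Set Implicit Arguments.
Unset Strict Implicit.
Unset Printing Implicit Defensive.

Record sgraph := SGraph {
  vertex :> finType;
  adj : rel vertex;
  adj_sym : symmetric adj;
  adj_irrefl : irreflexive adj
}.

Section Induced.
Variables (G : sgraph) (S : {set G}).

Definition induced_adj : rel {x : G | x \in S} :=
  fun x y => adj (val x) (val y).

Lemma induced_adj_sym : symmetric induced_adj.
Proof. by move=> x y; apply: adj_sym. Qed.

Lemma induced_adj_irrefl : irreflexive induced_adj.
Proof. by move=> x; apply: adj_irrefl. Qed.

Definition induced : sgraph := SGraph induced_adj_sym induced_adj_irrefl.

End Induced.

Definition sd_pair (G : sgraph) (x y : G) : nat :=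
  #|[set z : G | [&& z != x, z != y & adj z x (+) adj z y]]|.

(* As [sd_pair x y <= #|G|], the default value #|G| does not affect the
   minimum as soon as G has two distinct vertices (see [min_sd_pairP]). *)
Definition min_sd_pair (G : sgraph) : nat :=
  \big[minn/#|G|]_(p : G * G | p.1 != p.2) sd_pair p.1 p.2.

Lemma min_sd_pairP (G : sgraph) : 1 < #|G| ->
  (exists x y : G, x != y /\ min_sd_pair G = sd_pair x y) /\
  (forall x y : G, x != y -> min_sd_pair G <= sd_pair x y).
Proof.
have lb (x y : G) : x != y -> min_sd_pair G <= sd_pair x y.
  move=> xy; rewrite /min_sd_pair.
  elim: (index_enum _) (mem_index_enum (x, y)) => // p r IH.
  rewrite inE big_cons => /predU1P[<-|/IH le]; first by rewrite /= xy geq_minl.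
  by case: ifP => // _; rewrite geq_min le orbT.
move=> /card_gt1P[x [y [_ _ xy]]]; split=> //.
have: min_sd_pair G = #|G| \/
      exists x y : G, x != y /\ min_sd_pair G = sd_pair x y.
  rewrite /min_sd_pair; elim/big_ind: _ => [|a b Ha Hb|[u v] /= uv].
  - by left.
  - by rewrite /minn; case: ifP.
  - by right; exists u, v.
case=> // eqG; exists x, y; split=> //; apply/eqP.
by rewrite eqn_leq lb //= eqG max_card.
Qed.

(* The index set of the maximum is empty when G has at most one vertex, in
   which case \max is 0, the conventional value of sd. *)
Definition sd (G : sgraph) : nat :=
  \max_(S : {set G} | 1 < #|S|) min_sd_pair (induced S).

Local Open Scope ring_scope.
Local Open Scope classical_set_scope.

Definition box (R : realType) (d : nat) (a b : 'rV[R]_d) : set 'rV[R]_d :=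
  [set x : 'rV[R]_d | forall i, a ord0 i <= x ord0 i <= b ord0 i].

Definition is_unit_box (R : realType) (d : nat) (B : set 'rV[R]_d) : Prop :=
  exists a b : 'rV[R]_d,
    B = box a b /\ forall i, b ord0 i - a ord0 i = 1.

Definition unit_box_graph (R : realType) (d : nat) (G : sgraph) : Prop :=
  exists B : G -> set 'rV[R]_d,
    (forall v, is_unit_box (B v)) /\
    (forall x y : G, x != y -> (adj x y <-> B x `&` B y !=set0)).

(* Main.v *)
Require Import Defs.
From mathcomp Require Import all_boot all_order all_algebra.
From mathcomp Require Import classical_sets reals.
From mathcomp Require Import zify lra.

(* Take the grid points (i/m, j/m) with 0 <= i, j <= 2m as lower-left corners.
   Two unit boxes intersect iff |i - i'| <= m and |j - j'| <= m.  On the line,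
   the closed neighbourhoods in {0, ..., 2m} for the relation |i - i'| <= m are
   pairwise distinct and have more than m elements.  If (i, j) and (i', j')
   differ, say i <> i', some z is close to exactly one of i and i', say to i;
   then (z, w) separates the two vertices for each of the more than m values
   of w close to j. *)

Import Order.TTheory GRing.Theory Num.Theory.

Local Open Scope ring_scope.

Lemma unit_boxes_meet (R : realType) (d : nat) (a b a' b' : 'rV[R]_d) :
  (forall c, b ord0 c - a ord0 c = 1) ->
  (forall c, b' ord0 c - a' ord0 c = 1) ->
  (box a b `&` box a' b' !=set0)%classic <->
  forall c, `|a ord0 c - a' ord0 c| <= 1.
Proof.
move=> ab ab'; split=> [[x [/= xB xB']] c|close].
  move: (xB c) (xB' c) (ab c) (ab' c) => /andP[? ?] /andP[? ?] ? ?.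
  by rewrite ler_norml; apply/andP; split; lra.
(* The coordinatewise larger lower end lies in both boxes: it exceeds each lower end by at most 1,
   the common side length. *)
exists (\row_c Num.max (a ord0 c) (a' ord0 c)).
split=> c; move: (close c) (ab c) (ab' c); rewrite ler_norml => /andP[? ?] ? ?;
  by rewrite mxE le_max ge_max lexx ?orbT /=; apply/andP; split; lra.
Qed.

Lemma sd_pairC (G : sgraph) (x y : G) : sd_pair x y = sd_pair y x.
Proof. by apply: eq_card => z; rewrite !inE andbCA addbC. Qed.

(** The vertices of [induced [set: G]] form a subtype rather than [G] itself; [val] matches the
    separating vertices on both sides. *)
Lemma sd_pair_induced_setT (G : sgraph) (x y : induced [set: G]) :
  sd_pair x y = sd_pair (val x) (val y).
Proof.
rewrite /sd_pair -(card_imset _ val_inj); apply: eq_card => z.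
apply/imsetP/idP => [[t + ->]|]; first by rewrite !inE.
rewrite inE => zP; exists (exist _ z (finset.in_setT z) : induced [set: G]) => //.
by rewrite inE.
Qed.

(** The whole vertex set is one of the candidates in the maximum defining [sd]. *)
Lemma leq_sd (G : sgraph) (n : nat) : (1 < #|G|)%N ->
  (forall x y : G, x != y -> (n <= sd_pair x y)%N) -> (n <= sd G)%N.
Proof.
move=> G1 nP; have T1 : (1 < #|[set: G]|)%N by rewrite cardsT.
apply: leq_trans (leq_bigmax_cond _ T1).
have I1 : (1 < #|induced [set: G]|)%N by rewrite card_sig.
have [[x [y [xy ->]]] _] := min_sd_pairP I1.
by rewrite sd_pair_induced_setT; apply: nP.
Qed.

Section GridGraph.
Variable m : nat.

Definition close : rel 'I_(2 * m).+1 :=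
  fun i j => (i <= j + m)%N && (j <= i + m)%N.

Lemma close_refl i : close i i.
Proof. by rewrite /close leq_addr. Qed.

Lemma close_sym : symmetric close.
Proof. by move=> i j; rewrite /close andbC. Qed.

Lemma close_separated i j : i != j -> exists z, close z i (+) close z j.
Proof.
wlog ij : i j / (i < j)%N => [hw|_].
  rewrite neq_ltn => /orP[] lt_ij; first by apply: hw; rewrite ?neq_ltn ?lt_ij.
  have [|z zP] := hw j i lt_ij; first by rewrite neq_ltn lt_ij.
  by exists z; rewrite addbC.
(* If [m <= i], the least point close to [i] is [i - m], too far below [j]. Otherwise
   [i + m + 1 <= 2m] is a grid value just too far above [i], yet still close to [j]. *)
have := ltn_ord j; case: (leqP m i) => mi j2m.
  exists (inord (i - m)); rewrite /close inordK; last lia.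
  have -> : (j <= i - m + m)%N = false by lia.
  by rewrite andbF addbF; lia.
exists (inord (i + m).+1); rewrite /close inordK; last lia.
have -> : ((i + m).+1 <= i + m)%N = false by lia.
by rewrite addFb; lia.
Qed.

Lemma card_close i : (m < #|[set j | close j i]|)%N.
Proof.
have i2m := ltn_ord i.
(* The subtraction truncates: the [m + 1] values run from [i - m] to [i] when [m <= i], and from 0
   to [m] otherwise. *)
pose f (t : 'I_m.+1) : 'I_(2 * m).+1 := inord (t + (i - m)).
have fE t : f t = (t + (i - m))%N :> nat.
  by rewrite inordK //; have := ltn_ord t; lia.
have finj : injective f.
  by move=> s t /(congr1 val) /=; rewrite !fE => st; apply: val_inj => /=; lia.
rewrite -[m.+1]card_ord -cardsT -(card_imset _ finj).
apply: subset_leq_card; apply/fintype.subsetP => j /imsetP[t _ ->].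
by rewrite inE /close fE; have := ltn_ord t; lia.
Qed.

Definition grid_vertex : finType := ('I_(2 * m).+1 * 'I_(2 * m).+1)%type.

Definition grid_close (x y : grid_vertex) : bool :=
  close x.1 y.1 && close x.2 y.2.

Definition grid_adj : rel grid_vertex :=
  fun x y => (x != y) && grid_close x y.

Lemma grid_adj_sym : symmetric grid_adj.
Proof.
by move=> x y; rewrite /grid_adj /grid_close eq_sym !(close_sym x.1, close_sym x.2).
Qed.

Lemma grid_adj_irrefl : irreflexive grid_adj.
Proof. by move=> x; rewrite /grid_adj eqxx. Qed.

Definition grid_graph : sgraph :=
  SGraph grid_adj_sym grid_adj_irrefl.

(** The successor pays for [x], which may lie in [A] but is not counted by [sd_pair]. Since
    [grid_close] is reflexive, [y] is never in [A]. *)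
Lemma leq_sd_pair_grid (x y : grid_graph) (A : {set grid_graph}) :
  (forall z, z \in A -> grid_close z x && ~~ grid_close z y) ->
  (#|A| <= (sd_pair x y).+1)%N.
Proof.
move=> AP; rewrite (cardsD1 x) -add1n leq_add ?leq_b1 // subset_leq_card //.
apply/fintype.subsetP => z; rewrite !inE => /andP[zx /AP /andP[zcx zcy]].
have zy : z != y.
  by apply: contraNneq zcy => ->; rewrite /grid_close !close_refl.
by rewrite /= /grid_adj zx zy zcx (negbTE zcy).
Qed.

Lemma sd_pair_grid_fst (x y : grid_graph) z :
  close z x.1 -> ~~ close z y.1 -> (m <= sd_pair x y)%N.
Proof.
move=> zx zy; rewrite -ltnS.
(* The separating set is a fibre over [z] with more than [m] points, so at least [m] remain if [x]
   is among them. *)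
apply: leq_trans (leq_sd_pair_grid x y
  (finset.setX [set z] [set j | close j x.2]) _).
  by rewrite cardsX cards1 mul1n card_close.
move=> [s t]; rewrite !inE /grid_close /= => /andP[/eqP-> ->].
by rewrite zx (negbTE zy).
Qed.

Lemma sd_pair_grid_snd (x y : grid_graph) z :
  close z x.2 -> ~~ close z y.2 -> (m <= sd_pair x y)%N.
Proof.
move=> zx zy; rewrite -ltnS.
apply: leq_trans (leq_sd_pair_grid x y
  (finset.setX [set i | close i x.1] [set z]) _).
  by rewrite cardsX cards1 muln1 card_close.
move=> [s t]; rewrite !inE /grid_close /= => /andP[-> /eqP->].
by rewrite zx (negbTE zy) andbF.
Qed.

Lemma sd_pair_grid (x y : grid_graph) :
  x != y -> (m <= sd_pair x y)%N.
Proof.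
(* Four cases: the coordinate that differs, and which of the two vertices [z] is close to;
   [sd_pairC] swaps their roles. *)
rewrite -pair_eqE negb_and => /orP[] /close_separated[z];
  case zx: (close z _); case zy: (close z _) => //= _.
- by apply: (sd_pair_grid_fst _ _ z); rewrite ?zy.
- by rewrite sd_pairC; apply: (sd_pair_grid_fst _ _ z); rewrite ?zx.
- by apply: (sd_pair_grid_snd _ _ z); rewrite ?zy.
- by rewrite sd_pairC; apply: (sd_pair_grid_snd _ _ z); rewrite ?zx.
Qed.

Hypothesis m_gt0 : (0 < m)%N.

Lemma leq_sd_grid : (m <= sd grid_graph)%N.
Proof.
apply: leq_sd => [|x y]; last exact: sd_pair_grid.
by rewrite card_prod card_ord; nia.
Qed.

(** Clearing the denominator and unfolding the absolute value leaves the two additive comparisons of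
    [close]. *)
Lemma close_scaled (R : realType) (i j : 'I_(2 * m).+1) :
  close i j = (`|i%:R / m%:R - j%:R / m%:R : R| <= 1).
Proof.
have m0 : 0 < m%:R :> R by rewrite ltr0n.
rewrite -mulrBl normrM normfV (gtr0_norm m0) ler_pdivrMr // mul1r.
by rewrite ler_distl lerBlDr -!natrD !ler_nat andbC.
Qed.

Lemma unit_box_grid (R : realType) : unit_box_graph R 2 grid_graph.
Proof.
pose a (v : grid_graph) : 'rV[R]_2 :=
  \row_c ((if c == ord0 then v.1 else v.2)%:R / m%:R).
pose b v : 'rV[R]_2 := a v + const_mx 1.
have ab v c : b v ord0 c - a v ord0 c = 1.
  by rewrite /b !mxE addrAC subrr add0r.
exists (fun v => box (a v) (b v)); split=> [v|x y xy].
  by exists (a v), (b v).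
have aE c : `|a x ord0 c - a y ord0 c| <= 1 =
    (if c == ord0 then close x.1 y.1 else close x.2 y.2).
  by rewrite !mxE; case: ifP => _; rewrite -close_scaled.
apply: iff_trans (iff_sym (unit_boxes_meet _ _ _ _ _ _ (ab x) (ab y))).
rewrite /= /grid_adj /grid_close xy /=; split=> [/andP[x1 x2] c|xyP].
  by rewrite aE; case: ifP.
by apply/andP; split; [have := xyP ord0|have := xyP ord_max]; rewrite aE.
Qed.

End GridGraph.

Theorem corollary5p5 (R : realType) (k : int) :
  exists G : sgraph, unit_box_graph R 2 G /\ k < (sd G)%:Z.
Proof.
(* The parameter [|k| + 1] is positive and exceeds [k] even when [k] is negative. *)
exists (grid_graph `|k|.+1); split; first exact: unit_box_grid.
by have := leq_sd_grid `|k|.+1 isT; lia.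
Qed.
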